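(* Suppose that for each $(\theta,z)\in\Theta\times\mathcal{Z}$ one has $F_{IA}(\theta)=T_N^\perp(\theta,z)$, and that the efficient score function $l^E$ is a generalised inference function. Then an inference function $\Phi:\mathcal{X}\times\Theta\to\mathbb{R}^q$ equivalent to the efficient score function attains the semiparametric Cramér–Rao bound; that is, $J_\Phi(\theta,z)^{-1}=J(\theta,z)^{-1}$ for all $(\theta,z)\in\Theta\times\mathcal{Z}$, where $J_\Phi$ is the Godambe information of $\Phi$ and $J(\theta,z)=\mathrm{Cov}_{\theta z}\{l^E(\cdot;\theta,z)\}$.
   Context: Setting. $\lambda$ is a $\sigma$-finite measure on a measurable space $(\mathcal{X},\mathcal{A})$; $\mathcal{P}^*=\{p(\cdot;\theta,z)=dP_{\theta z}/d\lambda:\theta\in\Theta,\ z\in\mathcal{Z}\}$ is a family of probability densities, $\Theta\subseteq\mathbb{R}^q$ is open, $\mathcal{Z}$ is an arbitrary set, $(\theta,z)\mapsto p(\cdot;\theta,z)$ is a bijection onto $\mathcal{P}^*$, and all densities are strictly positive. $L^2_0(P)$ is the space of $P$-square-integrable functions with $P$-mean zero; $\langle\cdot,\cdot\rangle_{\theta z}$ is the inner product of $L^2(P_{\theta z})$. The partial score function $l(\cdot;\theta,z)=\nabla_\theta p(\cdot;\theta,z)/p(\cdot;\theta,z)=(l_1,\dots,l_q)^T$ is well defined $\lambda$-a.e. and $l_i(\cdot;\theta,z)\in L^2_0(P_{\theta z})$. Nuisance tangent space. For $\theta\in\Theta$ let $\mathcal{P}^*_\theta=\{p(\cdot;\theta,z):z\in\mathcal{Z}\}$.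 The nuisance tangent set $T^0_N(\theta,z)$ is the set of $\nu\in L^2_0(P_{\theta z})$ for which there are a set $V\subseteq[0,\infty)$ containing $0$ and having $0$ as an accumulation point, a path $\{p_t\}_{t\in V}\subseteq\mathcal{P}^*_\theta$ and functions $\{r_t\}_{t\in V}\subseteq L^2(P_{\theta z})$ with $p_t=p+tp\nu+tpr_t$ for all $t\in V$, where $p=p(\cdot;\theta,z)$, and $\|r_t\|_{L^2(P_{\theta z})}\to0$ as $t\downarrow0$. $T_N(\theta,z)$ is the $L^2_0(P_{\theta z})$-closure of the linear span of $T_N^0(\theta,z)$, and $T_N^\perp(\theta,z)$ is its orthogonal complement in $L^2_0(P_{\theta z})$. The space $F_{IA}$. For $z,z_*\in\mathcal{Z}$, the $m$-parallel transport of $a\in L^2_0(P_{\theta z_*})$ from $z_*$ to $z$ is $\overset{(m)}{\Pi}{}_{z_*}^{z}a=\frac{p(\cdot;\theta,z_* )}{p(\cdot;\theta,z)}\,a$. Define $F_{IA}(\theta,z)=\{r\in T_N^\perp(\theta,z):\ \langle\overset{(m)}{\Pi}{}_{z_*}^{z}\nu_*,r\rangle_{\theta z}=0\ \text{for all } z_*\in\mathcal{Z},\ \nu_*\in T_N(\theta,z_* )\}$ (it is understood that the transported functions lie in $L^2(P_{\theta z})$, so that the inner products are defined). It is a closed subspace of $L^2_0(P_{\theta z})$, also written $F_{IA}(\theta)$. Scores. The efficient score function $l^E(\cdot;\theta,z)$ and the information score function $l^I(\cdot;\theta,z)$ have as $i$-th components the orthogonal projections in $L^2_0(P_{\theta z})$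 of $l_i(\cdot;\theta,z)$ onto $T_N^\perp(\theta,z)$ and onto $F_{IA}(\theta)$, respectively. $J(\theta,z)=\mathrm{Cov}_{\theta z}\{l^E(\cdot;\theta,z)\}$ is assumed nonsingular; $J(\theta,z)^{-1}$ is the semiparametric Cramér–Rao bound. Inference functions. An inference function is a map $\Phi:\mathcal{X}\times\Theta\to\mathbb{R}^q$ measurable in $x$; a quasi-inference function is a map $\Psi:\mathcal{X}\times\Theta\times\mathcal{Z}\to\mathbb{R}^q$ measurable in $x$. A quasi-inference function $\Psi$ is a generalised inference function if it is equivalent to an inference function: there is an inference function $\Phi$ and, for each $(\theta,z)$, a nonsingular $q\times q$ matrix $A(\theta,z)$ with $\Psi(x;\theta,z)=A(\theta,z)\Phi(x;\theta)$ for $\lambda$-almost every $x$. Godambe information. Let $E(\theta,z)=\mathrm{span}\{l_i^I(\cdot;\theta,z):i=1,\dots,q\}$. For $\Psi$ with components $\psi_i$ in $L^2_0(P_{\theta z})$, let $\psi_i^I$ be the orthogonal projection of $\psi_i$ onto $E(\theta,z)$. The (extended) sensitivity is the $q\times q$ matrix $S_\Psi(\theta,z)$ with $(i,j)$ entry $-\langle\psi^I_j,l^I_i\rangle_{\theta z}$, the variability is $V_\Psi(\theta,z)=\mathrm{E}_{\theta z}\{\Psi\Psi^T\}$, and the Godambe information is $J_\Psi(\theta,z)=S_\Psi(\theta,z)V_\Psi^{-1}(\theta,z)S_\Psi^T(\theta,z)$; its inverse is the asymptotic covariance of the associated estimators. *)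

(* Defs.v *)
From HB Require Import structures.
From mathcomp Require Import all_boot all_order all_algebra.
From mathcomp Require Import all_classical all_reals all_analysis.
Import Order.TTheory GRing.Theory Num.Theory.
Import numFieldNormedType.Exports.
Set Implicit Arguments.
Unset Strict Implicit.
Unset Printing Implicit Defensive.
Local Open Scope classical_set_scope.
Local Open Scope ring_scope.

(* Elements of L^2 are represented by measurable functions X -> R rather than
   by classes modulo almost everywhere equality.  Every identity that the
   theory reads in L^2 is therefore stated almost everywhere, and an orthogonal
   projection denotes one version of its class. *)

Section L2.
Context {d : measure_display} {X : measurableType d} {R : realType}.
Variable P : probability X R.
Implicit Types (S : set (X -> R)) (f g : X -> R).

Definition L20 : set (X -> R) :=
  [set f | f \in Lfun P 2%:E /\ ('E_P[f] = 0)%E].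

Definition inner f g : R := \int[P]_x (f x * g x).

Definition lin_span S : set (X -> R) :=
  [set f | exists n (c : 'I_n -> R) (s : 'I_n -> X -> R),
     (forall k, S (s k)) /\ f = \sum_(k < n) c k *: s k].

Definition closure_L20 S : set (X -> R) :=
  [set f | L20 f /\ forall e : R, 0 < e ->
     exists2 g, S g & ('N[P]_(2%:E)[EFin \o (f - g)%R] < e%:E)%E].

Definition ortho_L20 S : set (X -> R) :=
  [set f | L20 f /\ forall g, S g -> inner g f = 0].

Definition is_proj S f g : Prop :=
  S g /\ forall h, S h -> inner (f - g) h = 0.

(* A projection onto S (unique up to a null set); it exists as soon as f is in
   L^2_0 and S is a closed or finite-dimensional subspace, so that the default
   value 0 plays no role there. *)
Definition proj S f : X -> R := xget 0 [set g | is_proj S f g].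

End L2.

(* The data and the standing regularity assumptions.  The functions are total
   in the parameter, but only their values on Theta are constrained or used.
   The score is only determined almost everywhere by the densities, so a
   version with measurable components is part of the data. *)
Record model {d : measure_display} {X : measurableType d} {R : realType}
    (lambda : {sigma_finite_measure set X -> \bar R}) (q : nat) (Z : Type) :=
  Model {
  Theta : set 'cV[R]_q ;
  prob : 'cV[R]_q -> Z -> probability X R ;
  dens : 'cV[R]_q -> Z -> X -> R ;
  score : 'cV[R]_q -> Z -> X -> 'cV[R]_q ;
  Theta_open : open Theta ;
  dens_measurable : forall theta z, Theta theta ->
    measurable_fun setT (dens theta z) ;
  dens_gt0 : forall theta z x, Theta theta -> 0 < dens theta z x ;
  dens_prob : forall theta z (A : set X), Theta theta -> measurable A ->
    prob theta z A = (\int[lambda]_(x in A) (dens theta z x)%:E)%E ;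
  dens_inj : forall theta z theta' z', Theta theta -> Theta theta' ->
    {ae lambda, forall x, dens theta z x = dens theta' z' x} ->
    theta = theta' /\ z = z' ;
  score_grad : forall theta z, Theta theta ->
    {ae lambda, forall x, forall i : 'I_q,
      derivable (fun t => dens t z x) theta (delta_mx i 0) /\
      score theta z x i 0
        = 'D_(delta_mx i 0) (fun t => dens t z x) theta / dens theta z x} ;
  score_L20 : forall theta z (i : 'I_q), Theta theta ->
    L20 (prob theta z) (fun x => score theta z x i 0)
}.

Section Model.
Context {d : measure_display} {X : measurableType d} {R : realType}.
Context {lambda : {sigma_finite_measure set X -> \bar R}} {q : nat} {Z : Type}.
Variable M : model lambda q Z.
Implicit Types (theta : 'cV[R]_q) (z : Z).

Definition dens_family theta : set (X -> R) := range (dens M theta).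

Definition nuisance_tangent_set theta z : set (X -> R) :=
  let p := dens M theta z in
  let P := prob M theta z in
  [set nu | L20 P nu /\
    exists (V : set R) (pt r : R -> X -> R),
      [/\ V `<=` [set t | 0 <= t], V 0 & limit_point V 0] /\
      [/\ forall t, V t -> dens_family theta (pt t),
          forall t, V t -> r t \in Lfun P 2%:E,
          forall t, V t ->
            {ae lambda, forall x,
              pt t x = p x + t * p x * nu x + t * p x * r t x} &
          'N[P]_(2%:E)[EFin \o r t]%E @[t --> within V ((0 : R)^'+)] --> 0%E]].

Definition T_N theta z : set (X -> R) :=
  closure_L20 (prob M theta z) (lin_span (nuisance_tangent_set theta z)).

Definition T_N_perp theta z : set (X -> R) :=
  ortho_L20 (prob M theta z) (T_N theta z).

(* m-parallel transport from zs to z *)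
Definition transport theta zs z (a : X -> R) : X -> R :=
  fun x => dens M theta zs x / dens M theta z x * a x.

Definition transport_in_L2 : Prop :=
  forall theta z zs nu, Theta M theta -> T_N theta zs nu ->
    transport theta zs z nu \in Lfun (prob M theta z) 2%:E.

Definition F_IA theta z : set (X -> R) :=
  [set r | T_N_perp theta z r /\
    forall zs nu, T_N theta zs nu ->
      inner (prob M theta z) (transport theta zs z nu) r = 0].

Definition efficient_score (x : X) theta z : 'cV[R]_q :=
  \col_i proj (prob M theta z) (T_N_perp theta z)
              (fun y => score M theta z y i 0) x.

Definition information_score (x : X) theta z : 'cV[R]_q :=
  \col_i proj (prob M theta z) (F_IA theta z)
              (fun y => score M theta z y i 0) x.

Definition efficient_information theta z : 'M[R]_q :=
  \matrix_(i, j) fine (covariance (prob M theta z)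
    (fun x => efficient_score x theta z i 0)
    (fun x => efficient_score x theta z j 0)).

Definition inference_function (Phi : X -> 'cV[R]_q -> 'cV[R]_q) : Prop :=
  forall theta (i : 'I_q), Theta M theta ->
    measurable_fun setT (fun x => Phi x theta i 0).

Definition quasi_inference_function
    (Psi : X -> 'cV[R]_q -> Z -> 'cV[R]_q) : Prop :=
  forall theta z (i : 'I_q), Theta M theta ->
    measurable_fun setT (fun x => Psi x theta z i 0).

Definition equivalent_to (Psi : X -> 'cV[R]_q -> Z -> 'cV[R]_q)
    (Phi : X -> 'cV[R]_q -> 'cV[R]_q) : Prop :=
  forall theta z, Theta M theta ->
    exists2 A : 'M[R]_q, A \in unitmx &
      {ae lambda, forall x, Psi x theta z = A *m Phi x theta}.

Definition generalised_inference_function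
    (Psi : X -> 'cV[R]_q -> Z -> 'cV[R]_q) : Prop :=
  quasi_inference_function Psi /\
  exists2 Phi, inference_function Phi & equivalent_to Psi Phi.

Definition E_space theta z : set (X -> R) :=
  lin_span [set f | exists i : 'I_q,
    f = fun x => information_score x theta z i 0].

Section Godambe.
Variable Psi : X -> 'cV[R]_q -> Z -> 'cV[R]_q.

Definition sensitivity theta z : 'M[R]_q :=
  \matrix_(i, j) - inner (prob M theta z)
    (proj (prob M theta z) (E_space theta z) (fun x => Psi x theta z j 0))
    (fun x => information_score x theta z i 0).

Definition variability theta z : 'M[R]_q :=
  \matrix_(i, j) fine 'E_(prob M theta z)
    [(fun x => Psi x theta z i 0 * Psi x theta z j 0)%R]%E.

(* invmx fixes singular matrices, so S V^-1 S^T can only be invertible when V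
   and S are: an equation of its invmx with the inverse of a nonsingular matrix
   entails that both inverses involved are genuine. *)
Definition godambe_information theta z : 'M[R]_q :=
  sensitivity theta z *m invmx (variability theta z)
    *m (sensitivity theta z)^T.

End Godambe.
End Model.

(* Main.v *)
(* Under F_IA = T_N^perp the information score is the efficient score g, whose
   second-moment matrix is J.  If g = A Phi almost everywhere, put B = A^-1.
   Each component of Phi lies in the span E of the components of g up to a null
   set, so projecting onto E does not change it; hence S_Phi = - J B^T and
   V_Phi = B J B^T, and S_Phi V_Phi^-1 S_Phi^T collapses to J. *)
Require Import Defs.
From HB Require Import structures.
From mathcomp Require Import all_boot all_order all_algebra.
From mathcomp Require Import all_classical all_reals all_analysis.
From mathcomp Require Import measurable_realfun.
Import Order.TTheory GRing.Theory Num.Theory.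
Import numFieldNormedType.Exports.
Set Implicit Arguments.
Unset Strict Implicit.
Unset Printing Implicit Defensive.
Local Open Scope classical_set_scope.
Local Open Scope ring_scope.

(** The middle inverse factors as [invmx B^T *m invmx J *m invmx B]. The two signs cancel, symmetry
    of [J] turns the transposed factor into [B *m J], and the product telescopes. *)
Lemma invmx_sandwich (F : fieldType) (n : nat) (J B : 'M[F]_n) :
  J \in unitmx -> B \in unitmx -> J^T = J ->
  - (J *m B^T) *m invmx (B *m J *m B^T) *m (- (J *m B^T))^T = J.
Proof.
move=> uJ uB symJ.
have uBT : B^T \in unitmx by rewrite unitmx_tr.
have -> : invmx (B *m J *m B^T) = invmx B^T *m invmx J *m invmx B.
  have uBJB : B *m J *m B^T \in unitmx by rewrite !unitmx_mul uB uJ uBT.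
  (* Left multiplication by an invertible matrix is injective, so it suffices that both candidates
     multiply to the identity. *)
  apply: (can_inj (mulKmx uBJB)).
  rewrite mulmxV // -!mulmxA (mulmxA B^T) mulmxV // mul1mx.
  by rewrite (mulmxA J) mulmxV // mul1mx mulmxV.
rewrite linearN /= mulmxN !mulNmx opprK trmx_mul trmxK symJ !mulmxA.
by rewrite mulmxK // mulmxV // mul1mx mulVmx // mul1mx.
Qed.

Section InnerProduct.
Context {d : measure_display} {X : measurableType d} {R : realType}.
Variable P : probability X R.
Implicit Types f g h : X -> R.

Local Notation L2 := (Lfun P 2%:E).

Lemma Lfun2_measurable f : f \in L2 -> measurable_fun setT f.
Proof. by rewrite inE => /andP[/[!inE]]. Qed.

Lemma Lfun2_integrableM f g : f \in L2 -> g \in L2 ->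
  P.-integrable setT (EFin \o (fun x => f x * g x)).
Proof. by move=> Lf Lg; exact/Lfun1_integrable/Lfun2_mul_Lfun1. Qed.

Lemma Lfun2_sum (n : nat) (c : 'I_n -> R) (s : 'I_n -> X -> R) :
  (forall k, s k \in L2) -> \sum_(k < n) c k *: s k \in L2.
Proof.
have [L0 Llin] := Lfun_submod_closed P (lee1n (R := R) 2).
move=> Ls; elim/big_ind: _ => // [f g Lf Lg|k _].
  by rewrite -[f]scale1r; exact: Llin.
by rewrite -[c k *: s k]addr0; exact: Llin.
Qed.

Lemma L20_0 : L20 P 0.
Proof.
by split; [exact: (Lfun_cst P 0) | rewrite (expectation_cst P 0)].
Qed.

Lemma inner_expectation f g : inner P f g = fine 'E_P[f * g]%E.
Proof. by rewrite unlock. Qed.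

Lemma innerC f g : inner P f g = inner P g f.
Proof. by apply: eq_Rintegral => x _; rewrite mulrC. Qed.

Lemma innerBl f g h : f \in L2 -> g \in L2 -> h \in L2 ->
  inner P (f - g) h = inner P f h - inner P g h.
Proof.
move=> Lf Lg Lh; rewrite /inner -RintegralB //; try exact: Lfun2_integrableM.
by apply: eq_Rintegral => x _; rewrite -mulrBl.
Qed.

Lemma innerDl f g h : f \in L2 -> g \in L2 -> h \in L2 ->
  inner P (f + g) h = inner P f h + inner P g h.
Proof.
move=> Lf Lg Lh; rewrite /inner -RintegralD //; try exact: Lfun2_integrableM.
by apply: eq_Rintegral => x _; rewrite -mulrDl.
Qed.

Lemma innerZl (a : R) f h : f \in L2 -> h \in L2 ->
  inner P (a *: f) h = a * inner P f h.
Proof.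
move=> Lf Lh; rewrite /inner -RintegralZl //; try exact: Lfun2_integrableM.
by apply: eq_Rintegral => x _; rewrite mulrA.
Qed.

Lemma inner0l h : inner P 0 h = 0.
Proof.
rewrite /inner (@eq_Rintegral _ _ _ _ _ (fun=> 0)) ?Rintegral_cst ?mul0r //.
by move=> x _; rewrite mul0r.
Qed.

Lemma inner_suml (n : nat) (c : 'I_n -> R) (s : 'I_n -> X -> R) h :
  (forall k, s k \in L2) -> h \in L2 ->
  inner P (\sum_(k < n) c k *: s k) h = \sum_(k < n) c k * inner P (s k) h.
Proof.
move=> Ls Lh; elim: n => [|n IHn] in c s Ls *.
  by rewrite !big_ord0 inner0l.
have Lsum := @Lfun2_sum n _ (fun k => s (widen_ord (leqnSn n) k)).
have LZ k : c k *: s k \in L2.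
  have := @Lfun2_sum 1 (fun=> c k) (fun=> s k) (fun=> Ls k).
  by rewrite big_ord1.
rewrite !big_ord_recr /= innerDl //; last exact: Lsum.
by rewrite IHn // innerZl.
Qed.

(** Stated for measurable functions because the components of an inference function are only assumed
    measurable; their square-integrability is not at hand. *)
Lemma ae_eq_innerl f g h :
  measurable_fun setT f -> measurable_fun setT g -> measurable_fun setT h ->
  {ae P, forall x, f x = g x} -> inner P f h = inner P g h.
Proof.
move=> mf mg mh fg; congr fine; apply: ae_eq_integral => //.
- by apply/measurable_EFinP; exact: measurable_funM.
- by apply/measurable_EFinP; exact: measurable_funM.
- by apply: filterS fg => x /= -> _.
Qed.

(** The product of the means vanishes. This makes [efficient_information] the Gram matrix of the
    efficient score. *)
Lemma fine_covariance_L20 f g : L20 P f -> L20 P g ->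
  fine (covariance P f g) = inner P f g.
Proof.
move=> [Lf Ef] [Lg Eg].
have sub12 : {subset L2 <= Lfun P 1}.
  by apply: Lfun_subset12; exact: fin_num_measure.
rewrite covarianceE; [|exact: sub12|exact: sub12|exact: Lfun2_mul_Lfun1].
by rewrite Ef mul0e sube0 inner_expectation.
Qed.

(* Holds even when no projection exists, since the default value 0 is in L20. *)
Lemma proj_L20 (S : set (X -> R)) f : S `<=` L20 P -> L20 P (Defs.proj P S f).
Proof.
by move=> SL; rewrite /Defs.proj; case: xgetP => [g _ [/SL]|_] //; exact: L20_0.
Qed.

(* An element of S agreeing with f almost everywhere is a projection of f; so
   [proj] does not take its default value here, but possibly another version. *)
Lemma inner_proj_ae (S : set (X -> R)) f u h : S `<=` [set g | g \in L2] ->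
  measurable_fun setT f -> S u -> {ae P, forall x, f x = u x} -> S h ->
  inner P (Defs.proj P S f) h = inner P u h.
Proof.
move=> SL mf Su fu Sh.
have mS g : S g -> measurable_fun setT g by move/SL; exact: Lfun2_measurable.
(* [f] is merely measurable, so linearity is applied to [u - g], which equals [f - g] almost
   everywhere. *)
have diffE g k : S g -> S k -> inner P (f - g) k = inner P u k - inner P g k.
  move=> Sg Sk; rewrite -innerBl; try exact: SL.
  apply: ae_eq_innerl; [| |exact: mS|].
  - by apply: measurable_funB => //; exact: mS.
  - by apply: measurable_funB; exact: mS.
  - by apply: filterS fu => x /= fux; rewrite !fctE fux.
have up : is_proj P S f u by split=> // k Sk; rewrite diffE // subrr.
rewrite /Defs.proj; case: xgetP => [g _ [Sg /(_ _ Sh)]|/(_ u) //].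
by rewrite diffE // => /eqP; rewrite subr_eq0 => /eqP.
Qed.

End InnerProduct.

Section Model.
Context {d : measure_display} {X : measurableType d} {R : realType}.
Context {lambda : {sigma_finite_measure set X -> \bar R}} {q : nat} {Z : Type}.
Variable M : model lambda q Z.

(** A measure with a density with respect to [lambda] gives no mass to [lambda]-null sets.
    Equivalence of inference functions holds [lambda]-a.e., whereas inner products are taken under
    [prob M theta z]. *)
Lemma ae_prob (theta : 'cV[R]_q) (z : Z) (Q : X -> Prop) : Theta M theta ->
  {ae lambda, forall x, Q x} -> {ae prob M theta z, forall x, Q x}.
Proof.
move=> Tt [N [mN N0 QN]]; exists N; split=> //.
rewrite dens_prob //; apply: null_set_integral => //.
apply/measurable_EFinP; apply: measurable_funTS; exact: dens_measurable.
Qed.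

Lemma T_N_perp_L20 (theta : 'cV[R]_q) (z : Z) :
  T_N_perp M theta z `<=` L20 (prob M theta z).
Proof. by move=> f []. Qed.

Lemma E_space_Lfun2 (theta : 'cV[R]_q) (z : Z) :
  (forall i : 'I_q,
     (fun x => information_score M x theta z i 0)
       \in Lfun (prob M theta z) 2%:E) ->
  E_space M theta z `<=` [set f | f \in Lfun (prob M theta z) 2%:E].
Proof.
move=> LI _ [n [c [s [sI ->]]]]; apply: Lfun2_sum => k.
by have [i ->] := sI k.
Qed.

End Model.

Theorem proposition17 (d : measure_display) (X : measurableType d)
    (R : realType) (lambda : {sigma_finite_measure set X -> \bar R})
    (q : nat) (Z : Type) (M : model lambda q Z)
    (htransport : transport_in_L2 M)
    (hJ : forall (theta : 'cV[R]_q) (z : Z), Theta M theta ->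
       efficient_information M theta z \in unitmx)
    (hFIA : forall (theta : 'cV[R]_q) (z : Z), Theta M theta ->
       F_IA M theta z = T_N_perp M theta z)
    (hgen : generalised_inference_function M (efficient_score M))
    (Phi : X -> 'cV[R]_q -> 'cV[R]_q)
    (hPhi : inference_function M Phi)
    (hequiv : equivalent_to M (efficient_score M) Phi)
    (theta : 'cV[R]_q) (z : Z) (htheta : Theta M theta) :
  invmx (godambe_information M (fun x t _ => Phi x t) theta z)
    = invmx (efficient_information M theta z).
Proof.
set J := efficient_information M theta z.
set P := prob M theta z.
pose g (i : 'I_q) x := efficient_score M x theta z i 0.
(* Equal sets make the two [proj] terms the same term, so the chosen versions agree everywhere, not
   only almost everywhere. *)
have infoE i : (fun x => information_score M x theta z i 0) = g i.
  by rewrite /information_score hFIA.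
have gL20 i : L20 P (g i).
  have -> : g i = Defs.proj P (T_N_perp M theta z)
                    (fun y => score M theta z y i 0).
    by apply/funext => x; rewrite /g /efficient_score mxE.
  by apply: proj_L20; exact: T_N_perp_L20.
have gL2 i : g i \in Lfun P 2%:E by have [] := gL20 i.
have JE i j : J i j = inner P (g i) (g j).
  by rewrite mxE; exact: fine_covariance_L20 (gL20 i) (gL20 j).
have symJ : J^T = J by apply/matrixP => i j; rewrite mxE !JE innerC.
have EL : E_space M theta z `<=` [set f | f \in Lfun P 2%:E].
  by apply: E_space_Lfun2 => i; rewrite infoE.
(* The free length and index map serve two cases: length one gives each [g i], length [q] gives each
   [u j] below. *)
have Egen n (c : 'I_n -> R) (s : 'I_n -> 'I_q) :
    E_space M theta z (\sum_(k < n) c k *: g (s k)).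
  exists n, c, (fun k => g (s k)); split=> // k.
  by exists (s k); rewrite infoE.
have Eg i : E_space M theta z (g i).
  have := Egen 1%N (fun=> 1) (fun=> i).
  by rewrite big_ord1 scale1r.
have [A uA /(@ae_prob _ _ _ _ _ _ M theta z _ htheta) gA] :=
  hequiv theta z htheta.
pose B := invmx A.
pose f (j : 'I_q) x := Phi x theta j 0.
(* Row [j] of [B] applied to the efficient score: a version of [f j] that lies in the span
   itself. *)
pose u (j : 'I_q) : X -> R := \sum_(k < q) B j k *: g k.
have mf j : measurable_fun setT (f j) by exact: hPhi.
have Eu j : E_space M theta z (u j) by exact: Egen.
have Lu j : u j \in Lfun P 2%:E by exact: EL.
have fu j : {ae P, forall x, f j x = u j x}.
  apply: filterS gA => x gAx.
  rewrite /f -(mulKmx uA (Phi x theta)) -gAx mxE /u.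
  rewrite fct_sumE; apply: eq_bigr => k _.
  by rewrite fctE.
have uB : B \in unitmx by rewrite unitmx_inv.
have uh j h : h \in Lfun P 2%:E ->
    inner P (u j) h = \sum_(k < q) B j k * inner P (g k) h.
  by move=> Lh; rewrite inner_suml.
(* The component of [Phi] is indexed by the column of the sensitivity, which is why [B] enters
   transposed and on the right. *)
have SE : sensitivity M (fun x t _ => Phi x t) theta z = - (J *m B^T).
  apply/matrixP => i j; rewrite !mxE; congr (- _).
  rewrite infoE (@inner_proj_ae _ _ _ P _ (f j) (u j)) // uh //.
  by apply: eq_bigr => k _; rewrite JE mxE mulrC innerC.
have VE : variability M (fun x t _ => Phi x t) theta z = B *m J *m B^T.
  apply/matrixP => i j; rewrite mxE -[LHS](inner_expectation P (f i) (f j)).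
  have mu k : measurable_fun setT (u k) by exact: Lfun2_measurable (Lu k).
  (* Replacement acts on the first argument only; symmetry brings [f j] there after [f i] has been
     replaced. *)
  rewrite (ae_eq_innerl (g := u i)) // innerC (ae_eq_innerl (g := u j)) //.
  rewrite uh // mxE; apply: eq_bigr => k _.
  rewrite innerC uh // !mxE mulrC; congr (_ * _).
  by apply: eq_bigr => l _; rewrite JE.
by rewrite /godambe_information SE VE invmx_sandwich // hJ.
Qed.
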